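(* Let $L$ be a totally disconnected locally compact group with $\mathrm{VZ}(L)=\{1\}$, let $G$ be an open compact subgroup of $L$, and let $\eta:G\to L$ be the inclusion map. The following conditions are equivalent: (a) $L$ is rigid. (b) $\kappa_{L,G}:\mathrm{Aut}(L)_S\to\mathrm{Comm}(G)_S$ is an isomorphism (of topological groups). (c) $\eta_*(L)$ is a normal subgroup of $\mathrm{Comm}(G)$.
   Context: For a topological group $L$, the virtual center is $\mathrm{VZ}(L)=\{g\in L: \text{the centralizer of } g \text{ in } L \text{ is open in } L\}$. Commensurator of a profinite group $G$: a virtual automorphism of $G$ is a topological isomorphism between two open subgroups of $G$; two are equivalent if they coincide on some open subgroup; the equivalence classes $[\phi]$ form, under composition (after restricting to suitable open subgroups), a group $\mathrm{Comm}(G)$. For an open subgroup $U$ of $G$, $\iota_U:U\to\mathrm{Comm}(G)$ sends $g$ to the class of the automorphism $x\mapsto gxg^{-1}$ of $U$. $\mathrm{Comm}(G)_S$ denotes $\mathrm{Comm}(G)$ with the strong topology: the unique group topology for which $\{\iota_U(U): U \text{ open subgroup of } G\}$ is a base of neighborhoods of $1$. For $G$ an open compact subgroup of $L$ with inclusion $\eta$, the homomorphism $\eta_*:L\to\mathrm{Comm}(G)$ sends $l$ to the class of $x\mapsto lxl^{-1}$, $G\cap l^{-1}Gl\to lGl^{-1}\cap G$. $\mathrm{Aut}(L)$ is the group of continuous automorphisms of $L$ (topological group automorphisms). $\mathrm{Aut}(L)_S$ denotes $\mathrm{Aut}(L)$ with the strong topology: the unique group topology for which the subgroups $i(U)=\{i_g: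 g\in U\}$, $U$ an open subgroup of $L$, form a base of neighborhoods of $1$, where $i_g(x)=gxg^{-1}$. The homomorphism $\kappa_{L,G}:\mathrm{Aut}(L)_S\to\mathrm{Comm}(G)_S$ sends $\alpha$ to the class of the virtual automorphism $\alpha|_{G\cap\alpha^{-1}(G)}:G\cap\alpha^{-1}(G)\to\alpha(G)\cap G$ of $G$. A totally disconnected locally compact group $L$ is called rigid if for every topological isomorphism $\phi:U\to V$ between open compact subgroups $U$ and $V$ of $L$ there exists a unique $\phi_\circ\in\mathrm{Aut}(L)$ with $\phi_\circ|_U=\phi$. *)

(* Defs.v *)
From HB Require Import structures.
Set Warnings "-notation-overridden,-redundant-canonical-projection".
Set Warnings "-notation-incompatible-prefix".
From mathcomp Require Import all_boot.
From mathcomp Require Import boolp classical_sets functions topology.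

Set Implicit Arguments.
Unset Strict Implicit.
Unset Printing Implicit Defensive.

Local Open Scope classical_set_scope.
Local Open Scope quotient_scope.
Local Open Scope group_scope.

HB.mixin Record isTopologicalGroup K & Group K & Topological K := {
  mulg_continuous : continuous (fun p : K * K => p.1 * p.2) ;
  invg_continuous : continuous (fun x : K => x^-1) }.

#[short(type="topologicalGroupType")]
HB.structure Definition TopologicalGroup :=
  {K of Group K & Topological K & isTopologicalGroup K}.

Record is_subgroup (K : groupType) (H : set K) : Prop := IsSubgroup {
  subgroup1 : H 1 ;
  subgroupM : forall x y, H x -> H y -> H (x * y) ;
  subgroupV : forall x, H x -> H x^-1 }.

Definition is_normal (K : groupType) (H : set K) : Prop :=
  is_subgroup H /\ forall x h, H h -> H (x * h * x^-1).

Lemma is_subgroupI (K : groupType) (A B : set K) :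
  is_subgroup A -> is_subgroup B -> is_subgroup (A `&` B).
Proof.
move=> [a1 aM aV] [b1 bM bV]; split=> //.
- by move=> x y [? ?] [? ?]; split; [apply: aM | apply: bM].
- by move=> x [? ?]; split; [apply: aV | apply: bV].
Qed.

Lemma is_subgroupT (K : groupType) : is_subgroup [set: K].
Proof. by []. Qed.

(* The group topology having the given family of subgroups as a base of
   neighborhoods of 1. *)
HB.factory Record Group_hasSubgroupBase K & Group K := {
  base1 : set (set K) ;
  base1_neq0 : base1 !=set0 ;
  base1_subgroup : forall U, base1 U -> is_subgroup U ;
  base1I : forall U V, base1 U -> base1 V ->
    exists2 W, base1 W & W `<=` U `&` V ;
  base1J : forall x U, base1 U ->
    exists2 V, base1 V & forall y, V y -> U (x * y * x^-1) }.

HB.builders Context K & Group_hasSubgroupBase K.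

Definition strong_nbhs (x : K) : set_system K :=
  [set A | exists2 U, base1 U & forall u, U u -> A (x * u)].

HB.instance Definition _ := hasNbhs.Build K strong_nbhs.

Lemma strong_nbhs_filter (x : K) : ProperFilter (strong_nbhs x).
Proof.
split.
  by case=> U bU /(_ 1) []; exact: subgroup1 (base1_subgroup bU).
split.
- by have [U bU] := base1_neq0; exists U.
- move=> A B [U bU UA] [V bV VB]; have [W bW WUV] := base1I bU bV.
  by exists W => // w /WUV[/UA ? /VB ?].
- by move=> A B AB [U bU UA]; exists U => // u /UA /AB.
Qed.

Lemma strong_nbhs_singleton (x : K) (A : set K) : strong_nbhs x A -> A x.
Proof.
by move=> [U /base1_subgroup sU /(_ 1 (subgroup1 sU))]; rewrite mulg1.
Qed.

Lemma strong_nbhs_nbhs (x : K) (A : set K) :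
  strong_nbhs x A -> strong_nbhs x (strong_nbhs^~ A).
Proof.
move=> [U bU UA]; exists U => // u Uu; exists U => // v Uv.
by rewrite -mulgA; apply/UA/(subgroupM (base1_subgroup bU)).
Qed.

HB.instance Definition _ := Nbhs_isNbhsTopological.Build K
  strong_nbhs_filter strong_nbhs_singleton strong_nbhs_nbhs.

Lemma strong_mulg_continuous : continuous (fun p : K * K => p.1 * p.2).
Proof.
move=> [x y] A [U bU UA]; have [V bV VU] := base1J y^-1 bU.
exists ([set z | V (x^-1 * z)], [set z | U (y^-1 * z)]).
  by split=> /=; [exists V => // v; rewrite /= mulKg | exists U => // v; rewrite /= mulKg].
move=> [z t] /= [Vz Ut].
have /VU Uz := Vz; rewrite invgK in Uz.
have := UA _ (subgroupM (base1_subgroup bU) Uz Ut).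
by rewrite /= !mulgA !mulgK mulgV mul1g.
Qed.

Lemma strong_invg_continuous : continuous (fun x : K => x^-1).
Proof.
move=> x A [U bU UA]; have [V bV VU] := base1J x bU.
exists V => // v /(subgroupV (base1_subgroup bV)) /VU /UA.
by rewrite /= invgM !mulgA mulVg mul1g.
Qed.

HB.instance Definition _ := isTopologicalGroup.Build K
  strong_mulg_continuous strong_invg_continuous.

HB.end.

(* f is only considered on U: it restricts to an isomorphism of topological
   groups from U onto V, for the subspace topologies. *)
Record top_iso (K M : topologicalGroupType) (U : set K) (V : set M)
    (f : K -> M) : Prop := TopIso {
  top_iso_bij : set_bij U V f ;
  top_isoM : forall x y, U x -> U y -> f (x * y) = f x * f y ;
  top_iso_continuous : {within U, continuous f} ;
  top_isoV_continuous :
    exists2 g : M -> K, (forall x, U x -> g (f x) = x)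
                      & {within V, continuous g} }.

Section TopIsoTheory.
Implicit Types K M N : topologicalGroupType.

Lemma within_continuous_comp K M N (U : set K) (V : set M)
    (f : K -> M) (g : M -> N) : (forall x, U x -> V (f x)) ->
  {within U, continuous f} -> {within V, continuous g} ->
  {within U, continuous (g \o f)}.
Proof.
move=> UV /subspace_continuousP cf /subspace_continuousP cg.
apply/subspace_continuousP => x Ux A /(cg _ (UV _ Ux)) nA.
have /(cf _ Ux) nB := nA; rewrite /= !nbhs_simpl /= in nB *.
rewrite /nbhs /= /within /= in nB *.
by apply: filterS nB => y + Uy; apply => //; exact: UV.
Qed.

Lemma top_iso_id K (U : set K) : top_iso U U id.
Proof.
have c : {within U, continuous (id : K -> K)}.
  by apply: continuous_subspaceT => x; exact: cvg_id.
split=> //; last by exists id.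
by split=> //; move=> x Ux; exists x.
Qed.

Lemma top_iso_sym K M (U : set K) (V : set M) f : is_subgroup U ->
  top_iso U V f ->
  exists g, top_iso V U g /\ (forall x, U x -> g (f x) = x) /\
            (forall y, V y -> f (g y) = y).
Proof.
move=> sU [[fUV /= finj fsurj] fM cf [g gK cg]]; exists g.
have gV y : V y -> U (g y) by move=> /fsurj[x Ux <-]; rewrite gK.
have Kg y : V y -> f (g y) = y by move=> /fsurj[x Ux <-]; rewrite gK.
split=> //; split=> //.
- split=> //.
  + by move=> y y' /set_mem Vy /set_mem Vy' e; rewrite -(Kg _ Vy) e Kg.
  + by move=> x Ux; exists (f x); [exact: fUV | exact: gK].
- move=> y y' Vy Vy'; rewrite -{1}(Kg _ Vy) -{1}(Kg _ Vy') -fM ?gK//; try exact: gV.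
  by apply: (subgroupM sU); exact: gV.
- by exists f.
Qed.

Lemma top_iso_comp K M N (U : set K) (V : set M) (W : set N) f g :
  top_iso U V f -> top_iso V W g -> top_iso U W (g \o f).
Proof.
move=> [[fUV finj fsurj] fM cf [f' fK cf']] [[gVW ginj gsurj] gM cg [g' gK cg']].
have fV x : U x -> V (f x) by exact: fUV.
split.
- split.
  + by move=> x /fV /gVW.
  + move=> x y Ux Uy /= e; apply: finj => //; apply: ginj => //;
      by apply: mem_set; apply: fV; exact: set_mem.
  + by move=> z /gsurj[y Vy <-]; have [x Ux <-] := fsurj _ Vy; exists x.
- by move=> x y Ux Uy /=; rewrite fM // gM //; exact: fV.
- exact: within_continuous_comp fV cf cg.
- exists (f' \o g'); first by move=> x Ux /=; rewrite gK ?fK//; exact: fV.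
  apply: within_continuous_comp cg' cf' => z /gsurj[y Vy <-].
  by rewrite gK.
Qed.

Lemma top_iso_restrict K M (U A : set K) (V : set M) f :
  A `<=` U -> top_iso U V f -> top_iso A (f @` A) f.
Proof.
move=> AU [[fUV finj fsurj] fM cf [g gK cg]]; split.
- split=> //.
  + by move=> x y /set_mem/AU Ux /set_mem/AU Uy; apply: finj; exact: mem_set.
- by move=> x y /AU Ux /AU Uy; exact: fM.
- exact: continuous_subspaceW cf.
- exists g; first by move=> x /AU /gK.
  by apply: continuous_subspaceW cg => _ [x /AU /fUV ? <-].
Qed.

Lemma top_iso_subgroup K M (U A : set K) (V : set M) f :
  is_subgroup U -> is_subgroup A -> A `<=` U -> top_iso U V f ->
  is_subgroup (f @` A).
Proof.
move=> sU sA AU tf; have fM := top_isoM tf.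
have f1 : f 1 = 1.
  have := fM _ _ (subgroup1 sU) (subgroup1 sU); rewrite mulg1.
  by move/(congr1 (fun z => (f 1)^-1 * z)); rewrite mulVg mulKg.
split.
- by exists 1; [exact: subgroup1 | exact: f1].
- move=> _ _ [x Ax <-] [y Ay <-]; exists (x * y); first exact: (subgroupM sA).
  by rewrite fM //; exact: AU.
- move=> _ [x Ax <-]; exists x^-1; first exact: (subgroupV sA).
  apply/esym/mulg1_eq; rewrite -fM ?mulgV//; first exact: AU.
  exact/AU/(subgroupV sA).
Qed.

Lemma top_iso_inner K (g : K) : top_iso setT setT (fun x => g * x * g^-1).
Proof.
have c (h : K) : continuous (fun x : K => h * x * h^-1).
  move=> x.
  have cl : (fun y : K => h * y) @ x --> h * x.
    apply: (@continuous2_cvg _ _ _ _ _ _ (cst h) id (fun a b : K => a * b)).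
    - exact: (@mulg_continuous K (h, x)).
    - exact: cvg_cst.
    - exact: cvg_id.
  apply: (@continuous2_cvg _ _ _ _ _ _ _ (cst h^-1) (fun a b : K => a * b)).
  - exact: (@mulg_continuous K (h * x, h^-1)).
  - exact: cl.
  - exact: cvg_cst.
split.
- split=> //.
  + by move=> x y _ _ /mulIg /mulgI.
  + move=> y _; exists (g^-1 * y * g) => //.
    by rewrite !mulgA mulgV mul1g mulgK.
- by move=> x y _ _; rewrite !mulgA mulgVK.
- exact: continuous_subspaceT (c g).
- exists (fun x => g^-1 * x * g^-1^-1); last exact: continuous_subspaceT.
  by move=> x _; rewrite invgK !mulgA mulVg mul1g mulgVK.
Qed.

End TopIsoTheory.

Section TopAut.
Variable L : topologicalGroupType.

Record TopAut : Type := MkTopAut {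
  aut_fun :> L -> L ;
  aut_iso : top_iso setT setT aut_fun }.

HB.instance Definition _ := gen_eqMixin TopAut.
HB.instance Definition _ := gen_choiceMixin TopAut.

Lemma TopAutP (a b : TopAut) : a =1 b -> a = b.
Proof.
case: a b => [f fP] [g gP] /= /funext fg; case: _ / fg in gP *.
by congr MkTopAut; exact: Prop_irrelevance.
Qed.

Definition aut_one : TopAut := MkTopAut (top_iso_id [set: L]).

Definition aut_mul (a b : TopAut) : TopAut :=
  MkTopAut (top_iso_comp (aut_iso b) (aut_iso a)).

Definition aut_inv (a : TopAut) : TopAut :=
  MkTopAut (projT2 (cid (top_iso_sym (is_subgroupT L) (aut_iso a)))).1.

Lemma aut_mulA : associative aut_mul.
Proof. by move=> a b c; exact: TopAutP. Qed.

Lemma aut_mul1 : left_id aut_one aut_mul.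
Proof. by move=> a; exact: TopAutP. Qed.

Lemma aut_1mul : right_id aut_one aut_mul.
Proof. by move=> a; exact: TopAutP. Qed.

Lemma aut_mulV : left_inverse aut_one aut_inv aut_mul.
Proof.
by move=> a; apply: TopAutP => x /=; case: cid => g /= [_ [gK _]]; exact: gK.
Qed.

Lemma aut_Vmul : right_inverse aut_one aut_inv aut_mul.
Proof.
by move=> a; apply: TopAutP => x /=; case: cid => g /= [_ [_ Kg]]; exact: Kg.
Qed.

HB.instance Definition _ := isGroup.Build TopAut
  aut_mulA aut_mul1 aut_1mul aut_mulV aut_Vmul.

Definition inner (g : L) : TopAut := MkTopAut (top_iso_inner g).

Lemma innerM g h : inner (g * h) = inner g * inner h.
Proof. by apply: TopAutP => x /=; rewrite invgM !mulgA. Qed.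

Lemma inner1 : inner 1 = 1.
Proof. by apply: TopAutP => x /=; rewrite invg1 mul1g mulg1. Qed.

Lemma innerV g : inner g^-1 = (inner g)^-1.
Proof. by apply/esym/mulg1_eq; rewrite -innerM mulgV inner1. Qed.

Lemma autM (a : TopAut) x y : a (x * y) = a x * a y.
Proof. by rewrite (top_isoM (aut_iso a)). Qed.

Lemma autV (a : TopAut) x : a x^-1 = (a x)^-1.
Proof.
apply/esym/mulg1_eq; rewrite -autM mulgV.
have := autM a 1 1; rewrite mulg1.
by move/(congr1 (fun z => (a 1)^-1 * z)); rewrite mulVg mulKg.
Qed.

Lemma aut_continuous (a : TopAut) : continuous a.
Proof. by apply/continuous_subspace_setT; exact: top_iso_continuous (aut_iso a). Qed.

Lemma innerJ (a : TopAut) g : a * inner g * a^-1 = inner (a g).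
Proof.
suff -> : a * inner g = inner (a g) * a by rewrite mulgK.
by apply: TopAutP => x /=; rewrite !autM autV.
Qed.

Lemma aut_preimage_subgroup (a : TopAut) (H : set L) :
  is_subgroup H -> is_subgroup (a @^-1` H).
Proof.
move=> sH; have a1 : a 1 = 1.
  by rewrite -{1}(mulgV (1 : L)) autM autV mulgV.
split=> /=.
- by rewrite a1; exact: subgroup1.
- by move=> x y Hx Hy; rewrite autM; exact: (subgroupM sH).
- by move=> x Hx; rewrite autV; exact: (subgroupV sH).
Qed.

Definition aut_base : set (set TopAut) :=
  [set inner @` U | U in [set U : set L | open U /\ is_subgroup U]].

Lemma aut_base_neq0 : aut_base !=set0.
Proof. by exists (inner @` setT), setT => //; split=> //; exact: openT. Qed.

Lemma aut_base_subgroup A : aut_base A -> is_subgroup A.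
Proof.
move=> [U [_ sU] <-]; split.
- by exists 1; [exact: subgroup1 | exact: inner1].
- move=> _ _ [x Ux <-] [y Uy <-]; exists (x * y); last exact: innerM.
  exact: (subgroupM sU).
- by move=> _ [x Ux <-]; exists x^-1; [exact: (subgroupV sU) | exact: innerV].
Qed.

Lemma aut_baseI A B : aut_base A -> aut_base B ->
  exists2 C, aut_base C & C `<=` A `&` B.
Proof.
move=> [U [oU sU] <-] [V [oV sV] <-]; exists (inner @` (U `&` V)).
  by exists (U `&` V) => //; split; [exact: openI | exact: is_subgroupI].
by move=> _ [x [Ux Vx] <-]; split; exists x.
Qed.

Lemma aut_baseJ a A : aut_base A ->
  exists2 B, aut_base B & forall b, B b -> A (a * b * a^-1).
Proof.
move=> [U [oU sU] <-]; exists (inner @` (a @^-1` U)).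
  exists (a @^-1` U) => //; split; last exact: aut_preimage_subgroup.
  by apply: open_comp => // x _; exact: aut_continuous.
by move=> _ [x Ux <-]; exists (a x) => //; rewrite innerJ.
Qed.

(* The strong topology is the only topology put on TopAut. *)
HB.instance Definition _ := Group_hasSubgroupBase.Build TopAut
  aut_base_neq0 aut_base_subgroup aut_baseI aut_baseJ.

Lemma nbhs1_TopAutE (A : set TopAut) :
  nbhs (1 : TopAut) A <->
  exists2 U : set L, open U /\ is_subgroup U & inner @` U `<=` A.
Proof.
split.
  move=> [_ [U oU <-] UA]; exists U => // _ [x Ux <-].
  by rewrite -[inner x]mul1g; apply: UA; exists x.
move=> [U oU UA]; exists (inner @` U); first by exists U.
by move=> u Uu; rewrite mul1g; exact: UA.
Qed.

End TopAut.

Section Commensurator.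
Variable L : topologicalGroupType.

Record subgroup : Type := Subgroup {
  subgroup_set :> set L ;
  subgroupP : is_subgroup subgroup_set }.

Variable G : subgroup.

Record open_subgroup : Type := OpenSubgroup {
  open_subgroup_set :> set L ;
  open_subgroup_is_subgroup : is_subgroup open_subgroup_set ;
  open_subgroup_sub : open_subgroup_set `<=` G ;
  open_subgroup_open : open (open_subgroup_set : set (subspace G)) }.

(* vfun is only meaningful on vdom; virtual automorphisms that differ outside
   it are identified in Comm. *)
Record virtual_aut : Type := VirtualAut {
  vdom : open_subgroup ;
  vcod : open_subgroup ;
  vfun :> L -> L ;
  viso : top_iso vdom vcod vfun }.

HB.instance Definition _ := gen_eqMixin virtual_aut.
HB.instance Definition _ := gen_choiceMixin virtual_aut.

Definition virtual_aut_eq (f g : virtual_aut) : Prop :=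
  exists2 W : open_subgroup, W `<=` vdom f `&` vdom g
    & forall x, (W : set L) x -> f x = g x.

Definition open_subgroupT : open_subgroup :=
  OpenSubgroup (subgroupP G) (@subset_refl _ _) (@open_subspaceT _ G).

Lemma open_subgroupI_subproof (U V : open_subgroup) :
  [/\ is_subgroup (U `&` V), U `&` V `<=` G &
      open (U `&` V : set (subspace G))].
Proof.
case: U V => [U sU UG oU] [V sV VG oV] /=; split.
- exact: is_subgroupI.
- by move=> x [/UG].
- exact: openI.
Qed.

Definition open_subgroupI (U V : open_subgroup) : open_subgroup :=
  let: And3 a b c := open_subgroupI_subproof U V in OpenSubgroup a b c.

Lemma open_subgroupIE U V : open_subgroupI U V = U `&` V :> set L.
Proof. by rewrite /open_subgroupI; case: open_subgroupI_subproof. Qed.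

Lemma vfun_in (f : virtual_aut) x : (vdom f : set L) x -> (vcod f : set L) (f x).
Proof. by case: (viso f) => [[fUV _ _] _ _ _]; exact: fUV. Qed.

Lemma vfunM (f : virtual_aut) x y :
  (vdom f : set L) x -> (vdom f : set L) y -> f (x * y) = f x * f y.
Proof. exact: top_isoM (viso f) x y. Qed.

Lemma vfun1 (f : virtual_aut) : f 1 = 1.
Proof.
have U1 := subgroup1 (open_subgroup_is_subgroup (vdom f)).
have := vfunM U1 U1; rewrite mulg1.
by move/(congr1 (fun z => (f 1)^-1 * z)); rewrite mulVg mulKg.
Qed.

Lemma vfunV (f : virtual_aut) x :
  (vdom f : set L) x -> f x^-1 = (f x)^-1.
Proof.
move=> Ux; apply/esym/mulg1_eq; rewrite -vfunM ?mulgV ?vfun1//.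
exact: (subgroupV (open_subgroup_is_subgroup (vdom f))).
Qed.

Lemma within_preimage_open (A B : set L) (f : L -> L) :
  open (A : set (subspace G)) -> A `<=` G ->
  {within A, continuous f} -> (forall x, A x -> (G : set L) (f x)) ->
  open (B : set (subspace G)) ->
  open ((A `&` f @^-1` B) : set (subspace G)).
Proof.
move=> /open_subspaceP[O oO OA] AG cf AfG /open_subspaceP[P oP PB].
have /continuousP/(_ _ oP) /open_subspaceP[Q oQ QE] := cf.
apply/open_subspaceP; exists (O `&` Q); first exact: openI.
have {}OA x : (O x /\ (G : set L) x) <-> A x.
  rewrite -[O x /\ (G : set L) x]/((O `&` G) x) OA; split=> [[]//|Ax]; split=> //.
  exact: AG.
have {}PB x : (G : set L) x -> P x <-> B x.
  move=> Gx; split=> [Px|Bx].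
    by have [] : (B `&` G) x by rewrite -PB.
  by have [] : (P `&` G) x by rewrite PB.
have {}QE x : A x -> Q x <-> P (f x).
  move=> Ax; split=> [Qx|Px].
    by have [] : (f @^-1` P `&` A) x by rewrite -QE.
  by have [] : (Q `&` A) x by rewrite QE.
apply/seteqP; split=> x /=.
  move=> [[Ox Qx] Gx]; have Ax : A x by apply/OA.
  by split=> //; split=> //; apply/PB; [exact: AfG | exact/QE].
move=> [[Ax Bx] Gx]; have [Ox _] := (OA x).2 Ax.
by split=> //; split=> //; apply/QE => //; apply/PB => //; exact: AfG.
Qed.

Lemma preimage_subproof (f : virtual_aut) (W : open_subgroup) :
  [/\ is_subgroup (vdom f `&` f @^-1` W), vdom f `&` f @^-1` W `<=` G &
      open (vdom f `&` f @^-1` W : set (subspace G))].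
Proof.
have sU := open_subgroup_is_subgroup (vdom f).
have sW := open_subgroup_is_subgroup W.
split.
- split=> /=.
  + split; first exact: subgroup1.
    by rewrite vfun1; exact: subgroup1.
  + move=> x y [Ux Wx] [Uy Wy]; split; first exact: (subgroupM sU).
    by rewrite /= vfunM//; exact: (subgroupM sW).
  + move=> x [Ux Wx]; split; first exact: (subgroupV sU).
    by rewrite /= vfunV//; exact: (subgroupV sW).
- by move=> x [Ux _]; exact: open_subgroup_sub Ux.
- apply: within_preimage_open; [exact: open_subgroup_open |
    exact: open_subgroup_sub | exact: top_iso_continuous (viso f) | |
    exact: open_subgroup_open].
  by move=> x /vfun_in /open_subgroup_sub.
Qed.

Definition preimage_subgroup (f : virtual_aut) (W : open_subgroup) :
    open_subgroup :=
  let: And3 a b c := preimage_subproof f W in OpenSubgroup a b c.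

Lemma preimage_subgroupE f W :
  preimage_subgroup f W = vdom f `&` f @^-1` W :> set L.
Proof. by rewrite /preimage_subgroup; case: preimage_subproof. Qed.

Lemma vinv_ex (f : virtual_aut) :
  exists g, top_iso (vcod f) (vdom f) g /\
    (forall x, (vdom f : set L) x -> g (f x) = x) /\ (forall y, (vcod f : set L) y -> f (g y) = y).
Proof. exact: top_iso_sym (open_subgroup_is_subgroup _) (viso f). Qed.

Definition virtual_inv (f : virtual_aut) : virtual_aut :=
  VirtualAut (projT2 (cid (vinv_ex f))).1.

Lemma virtual_invK (f : virtual_aut) x : (vdom f : set L) x -> virtual_inv f (f x) = x.
Proof. by rewrite /=; case: cid => g /= [_ [gK _]]; exact: gK. Qed.

Lemma virtual_invKV (f : virtual_aut) y : (vcod f : set L) y -> f (virtual_inv f y) = y.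
Proof. by rewrite /=; case: cid => g /= [_ [_ gK]]; exact: gK. Qed.

Lemma virtual_comp_subproof (f g : virtual_aut) :
  top_iso (preimage_subgroup g (vdom f))
    (preimage_subgroup (virtual_inv f) (vcod g)) (f \o g).
Proof.
have gi := viso g; have fi := viso f.
set A := preimage_subgroup g (vdom f).
set B := preimage_subgroup (virtual_inv f) (vcod g).
have AU : A `<=` vdom g by rewrite preimage_subgroupE => x [].
have Af : g @` A `<=` vdom f.
  by rewrite preimage_subgroupE => _ [x [_ ?] <-].
suff -> : (B : set L) = f @` (g @` A).
  exact: top_iso_comp (top_iso_restrict AU gi) (top_iso_restrict Af fi).
rewrite !preimage_subgroupE; apply/seteqP; split=> y /=.
  move=> [Vy Wy]; exists (virtual_inv f y); last exact: virtual_invKV.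
  have [[_ _ /(_ _ Wy)[x Ux xE]] _ _ _] := gi.
  exists x => //; split=> //; rewrite /= xE.
  exact: (@vfun_in (virtual_inv f)).
move=> [_ [x [Ux fx] <-] <-]; split; first exact: vfun_in.
by have := vfun_in Ux; rewrite -{1}(virtual_invK fx).
Qed.

Definition virtual_comp (f g : virtual_aut) : virtual_aut :=
  VirtualAut (virtual_comp_subproof f g).

Definition virtual_id : virtual_aut :=
  @VirtualAut open_subgroupT open_subgroupT id (top_iso_id _).

Lemma virtual_aut_eq_refl f : virtual_aut_eq f f.
Proof. by exists (vdom f). Qed.

Lemma virtual_aut_eq_sym f g : virtual_aut_eq f g -> virtual_aut_eq g f.
Proof. by move=> [W Wfg e]; exists W; [rewrite setIC | move=> x /e]. Qed.

Lemma virtual_aut_eq_trans g f h :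
  virtual_aut_eq f g -> virtual_aut_eq g h -> virtual_aut_eq f h.
Proof.
move=> [V Vfg eV] [W Wgh eW]; exists (open_subgroupI V W).
  by rewrite open_subgroupIE => x [/Vfg[? _] /Wgh[]].
by rewrite open_subgroupIE => x [Vx Wx]; rewrite eV// eW.
Qed.

Definition virtual_aut_eqb (f g : virtual_aut) : bool := `[< virtual_aut_eq f g >].

Lemma virtual_aut_eqb_refl : reflexive virtual_aut_eqb.
Proof. by move=> f; apply/asboolP; exact: virtual_aut_eq_refl. Qed.

Lemma virtual_aut_eqb_sym : symmetric virtual_aut_eqb.
Proof.
by move=> f g; apply/asboolP/asboolP; exact: virtual_aut_eq_sym.
Qed.

Lemma virtual_aut_eqb_trans : transitive virtual_aut_eqb.
Proof.
move=> g f h /asboolP fg /asboolP gh; apply/asboolP.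
exact: virtual_aut_eq_trans fg gh.
Qed.

Canonical virtual_aut_equiv := EquivRel virtual_aut_eqb
  virtual_aut_eqb_refl virtual_aut_eqb_sym virtual_aut_eqb_trans.

Definition Comm : Type := {eq_quot virtual_aut_eqb}.

HB.instance Definition _ := Choice.copy Comm {eq_quot virtual_aut_eqb}.

Definition comm_class (f : virtual_aut) : Comm :=
  \pi_({eq_quot virtual_aut_eqb}) f.

Definition comm_repr (c : Comm) : virtual_aut :=
  repr (c : {eq_quot virtual_aut_eqb}).

Lemma comm_reprK c : comm_class (comm_repr c) = c.
Proof. exact: reprK. Qed.

Lemma comm_classP f g : comm_class f = comm_class g <-> virtual_aut_eq f g.
Proof.
by split=> [/eqmodP/asboolP | ?]; last by apply/eqmodP/asboolP.
Qed.

Lemma comm_repr_class f : virtual_aut_eq (comm_repr (comm_class f)) f.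
Proof. by apply/comm_classP; exact: comm_reprK. Qed.

Definition comm_one : Comm := comm_class virtual_id.

Definition comm_mul (a b : Comm) : Comm :=
  comm_class (virtual_comp (comm_repr a) (comm_repr b)).

Definition comm_inv (a : Comm) : Comm :=
  comm_class (virtual_inv (comm_repr a)).

Lemma virtual_comp_eq f f' g g' : virtual_aut_eq f f' -> virtual_aut_eq g g' ->
  virtual_aut_eq (virtual_comp f g) (virtual_comp f' g').
Proof.
move=> [V Vf eV] [W Wg eW].
exists (open_subgroupI W (preimage_subgroup g V)).
  rewrite open_subgroupIE /= !preimage_subgroupE => x [Wx [gx Vx]].
  have [_ g'x] := Wg _ Wx; have [? ?] := Vf _ Vx.
  by split; split=> //=; rewrite -eW.
rewrite open_subgroupIE preimage_subgroupE => x [Wx [gx Vx]] /=.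
by rewrite -eW// eV.
Qed.

Lemma comm_mul_class f g :
  comm_mul (comm_class f) (comm_class g) = comm_class (virtual_comp f g).
Proof.
by apply/comm_classP; apply: virtual_comp_eq; exact: comm_repr_class.
Qed.

Lemma comm_mulA : associative comm_mul.
Proof.
move=> a b c; rewrite -(comm_reprK a) -(comm_reprK b) -(comm_reprK c).
move: (comm_repr a) (comm_repr b) (comm_repr c) => f g h.
rewrite !comm_mul_class; apply/comm_classP.
exists (vdom (virtual_comp f (virtual_comp g h))) => //.
move=> x Ux; split=> //; move: Ux.
by rewrite /= !preimage_subgroupE /= => -[[? ?] ?].
Qed.

Lemma comm_mul1 : left_id comm_one comm_mul.
Proof.
move=> a; rewrite -(comm_reprK a); move: (comm_repr a) => f.
rewrite comm_mul_class; apply/comm_classP; exists (vdom f) => // x fx.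
split=> //; rewrite /= preimage_subgroupE; split=> //=.
exact/open_subgroup_sub/vfun_in.
Qed.

Lemma comm_1mul : right_id comm_one comm_mul.
Proof.
move=> a; rewrite -(comm_reprK a); move: (comm_repr a) => f.
rewrite comm_mul_class; apply/comm_classP; exists (vdom f) => // x fx.
split=> //; rewrite /= preimage_subgroupE; split=> //=.
exact: open_subgroup_sub fx.
Qed.

Lemma comm_mulV : left_inverse comm_one comm_inv comm_mul.
Proof.
move=> a; rewrite -{2}(comm_reprK a) comm_mul_class; apply/comm_classP.
exists (vdom (comm_repr a)) => x Ux; last exact: virtual_invK.
split; last exact: open_subgroup_sub Ux.
by rewrite /= preimage_subgroupE; split=> //; exact: vfun_in.
Qed.

Lemma comm_Vmul : right_inverse comm_one comm_inv comm_mul.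
Proof.
move=> a; rewrite -{1}(comm_reprK a) comm_mul_class; apply/comm_classP.
exists (vcod (comm_repr a)) => x Ux; last exact: virtual_invKV.
split; last exact: open_subgroup_sub Ux.
rewrite [vdom _]/= preimage_subgroupE; split=> //=.
exact: (@vfun_in (virtual_inv (comm_repr a))).
Qed.

HB.instance Definition _ := isGroup.Build Comm
  comm_mulA comm_mul1 comm_1mul comm_mulV comm_Vmul.

Lemma comm_classM f g :
  comm_class f * comm_class g = comm_class (virtual_comp f g).
Proof. exact: comm_mul_class. Qed.

Lemma iota_subproof (U : open_subgroup) (g : U) :
  top_iso U U (inner (set_val g)).
Proof.
have sU := open_subgroup_is_subgroup U.
have Ug : (U : set L) (set_val g) by exact: set_valP.
suff E : inner (set_val g) @` U = U.
  by rewrite -{2}E; apply: top_iso_restrict (aut_iso _).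
apply/seteqP; split=> [_ [x Ux <-]|x Ux] /=.
  by apply: (subgroupM sU); [exact: (subgroupM sU) | exact: (subgroupV sU)].
exists ((set_val g)^-1 * x * set_val g).
  by apply: (subgroupM sU) => //; apply: (subgroupM sU) => //; exact: (subgroupV sU).
by rewrite !mulgA mulgV mul1g mulgK.
Qed.

Definition comm_iota (U : open_subgroup) (g : U) : Comm :=
  comm_class (VirtualAut (iota_subproof g)).

Lemma iota_eqP (U V : open_subgroup) (g : U) (f : virtual_aut) :
  V `<=` vdom f -> (forall x, (V : set L) x -> f x = inner (set_val g) x) ->
  comm_class f = comm_iota g.
Proof.
move=> Vf e; apply/comm_classP; exists (open_subgroupI V U).
  by rewrite open_subgroupIE => x [/Vf ? ?].
by rewrite open_subgroupIE => x [Vx _]; exact: e.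
Qed.

Lemma iotaM (U : open_subgroup) (g h k : U) :
  set_val k = set_val g * set_val h -> comm_iota k = comm_iota g * comm_iota h.
Proof.
move=> kgh; rewrite comm_classM; apply/esym/(@iota_eqP _ U) => x Ux.
  rewrite /= preimage_subgroupE; split=> //.
  exact: (@vfun_in (VirtualAut (iota_subproof h))).
by rewrite kgh innerM.
Qed.

Lemma iota1 (U : open_subgroup) (g : U) : set_val g = 1 -> comm_iota g = 1.
Proof.
move=> g1; apply/esym/(@iota_eqP _ U); last by rewrite g1 inner1.
exact: open_subgroup_sub.
Qed.

Lemma rangeT_mem (U : open_subgroup) (x : L) :
  (U : set L) x -> exists g : U, set_val g = x.
Proof. by move=> Ux; exists (SigSub (mem_set Ux)). Qed.

Lemma iota_range_sub (U V : open_subgroup) : U `<=` V ->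
  range (@comm_iota U) `<=` range (@comm_iota V).
Proof.
move=> UV _ [g _ <-]; have [h hg] := rangeT_mem (UV _ (set_valP g)).
exists h => //; apply/esym/(@iota_eqP _ U) => //= x Ux.
by rewrite hg.
Qed.

Definition comm_base : set (set Comm) :=
  [set range (@comm_iota U) | U in [set: open_subgroup]].

Lemma comm_base_neq0 : comm_base !=set0.
Proof. by exists (range (@comm_iota open_subgroupT)), open_subgroupT. Qed.

Lemma comm_base_subgroup A : comm_base A -> is_subgroup A.
Proof.
move=> [U _ <-]; have sU := open_subgroup_is_subgroup U.
have [u u1] := rangeT_mem (subgroup1 sU).
split.
- by exists u => //; exact: iota1.
- move=> _ _ [g _ <-] [h _ <-].
  have [k kE] := rangeT_mem (subgroupM sU (set_valP g) (set_valP h)).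
  by exists k => //; exact: iotaM.
- move=> _ [g _ <-]; have [h hE] := rangeT_mem (subgroupV sU (set_valP g)).
  exists h => //; apply/esym/mulg1_eq; rewrite -(@iotaM _ _ _ u) ?iota1//.
  by rewrite u1 hE mulgV.
Qed.

Lemma comm_baseI A B : comm_base A -> comm_base B ->
  exists2 C, comm_base C & C `<=` A `&` B.
Proof.
move=> [U _ <-] [V _ <-]; exists (range (@comm_iota (open_subgroupI U V))).
  by exists (open_subgroupI U V).
by move=> c cUV; split; apply: iota_range_sub cUV;
  rewrite open_subgroupIE => x [].
Qed.

Lemma comm_baseJ a A : comm_base A ->
  exists2 B, comm_base B & forall b, B b -> A (a * b * a^-1).
Proof.
move=> [U _ <-]; rewrite -(comm_reprK a); move: (comm_repr a) => f.
pose V := preimage_subgroup f U.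
have VE : V = vdom f `&` f @^-1` U :> set L by exact: preimage_subgroupE.
have VD : V `<=` vdom f by rewrite VE => x [].
exists (range (@comm_iota V)); first by exists V.
move=> _ [g _ <-]; have := set_valP g; rewrite {1}VE => -[fg Ufg].
have [h hE] := rangeT_mem Ufg.
exists h => //; suff -> : comm_class f * comm_iota g = comm_iota h * comm_class f.
  by rewrite mulgK.
rewrite !comm_classM; apply/comm_classP; exists V => x Vx.
  have := Vx; rewrite {1}VE => -[fx Ufx]; split; last first.
    by rewrite /= preimage_subgroupE.
  rewrite /= preimage_subgroupE; split=> //.
  exact: (VD _ (@vfun_in (VirtualAut (iota_subproof g)) _ Vx)).
have := Vx; rewrite {1}VE => -[fx Ufx].
have sU := open_subgroup_is_subgroup (vdom f).
rewrite /= hE /= !vfunM ?vfunV//; [exact: (subgroupM sU) |].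
exact: (subgroupV sU).
Qed.

(* The strong topology is the only topology put on Comm. *)
HB.instance Definition _ := Group_hasSubgroupBase.Build Comm
  comm_base_neq0 comm_base_subgroup comm_baseI comm_baseJ.

Lemma nbhs1_CommE (A : set Comm) :
  nbhs (1 : Comm) A <-> exists U : open_subgroup, range (@comm_iota U) `<=` A.
Proof.
split.
  move=> [_ [U _ <-] UA]; exists U => c cU.
  by rewrite -[c]mul1g; apply: UA.
move=> [U UA]; exists (range (@comm_iota U)); first by exists U.
by move=> u Uu; rewrite mul1g; exact: UA.
Qed.

End Commensurator.

Section Kappa.
Variables (L : topologicalGroupType) (G : subgroup L).
Hypothesis oG : open (G : set L).

Lemma aut_dom_subproof (a : TopAut L) :
  [/\ is_subgroup (G `&` a @^-1` G), G `&` a @^-1` G `<=` G &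
      open (G `&` a @^-1` G : set (subspace G))].
Proof.
split.
- apply: is_subgroupI; first exact: subgroupP.
  exact/aut_preimage_subgroup/subgroupP.
- exact: subIsetl.
- apply/open_subspaceW/openI => //.
  by apply: open_comp => // x _; exact: aut_continuous.
Qed.

Lemma aut_image_dom (a b : TopAut L) : cancel a b -> cancel b a ->
  a @` (G `&` a @^-1` G) = G `&` b @^-1` G.
Proof.
move=> aK bK; apply/seteqP; split=> x /=.
  by move=> [y [Gy Gay] <-]; rewrite aK.
by move=> [Gx Gbx]; exists (b x) => //; rewrite bK.
Qed.

Lemma aut_image_subE (a : TopAut L) : a @` (G `&` a @^-1` G) = a @` G `&` G.
Proof.
apply/seteqP; split=> x /=; first by move=> [y [Gy Gay] <-]; split=> //; exists y.
by move=> [[y Gy <-] Gay]; exists y.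
Qed.

Lemma aut_cod_subproof (a : TopAut L) :
  [/\ is_subgroup (a @` G `&` G), a @` G `&` G `<=` G &
      open (a @` G `&` G : set (subspace G))].
Proof.
rewrite -aut_image_subE (@aut_image_dom a a^-1); first exact: aut_dom_subproof.
  by move=> x; rewrite -[LHS]/((a^-1 * a) x) mulVg.
by move=> x; rewrite -[LHS]/((a * a^-1) x) mulgV.
Qed.

Definition aut_dom (a : TopAut L) : open_subgroup G :=
  let: And3 p q r := aut_dom_subproof a in OpenSubgroup p q r.

Definition aut_cod (a : TopAut L) : open_subgroup G :=
  let: And3 p q r := aut_cod_subproof a in OpenSubgroup p q r.

Lemma aut_domE a : aut_dom a = G `&` a @^-1` G :> set L.
Proof. by rewrite /aut_dom; case: aut_dom_subproof. Qed.

Lemma aut_codE a : aut_cod a = a @` G `&` G :> set L.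
Proof. by rewrite /aut_cod; case: aut_cod_subproof. Qed.

Lemma aut_restr_subproof (a : TopAut L) : top_iso (aut_dom a) (aut_cod a) a.
Proof.
rewrite aut_domE aut_codE -aut_image_subE.
exact: top_iso_restrict (aut_iso a).
Qed.

Definition aut_restr (a : TopAut L) : virtual_aut G :=
  VirtualAut (aut_restr_subproof a).

Definition kappa (a : TopAut L) : Comm G := comm_class (aut_restr a).

(* aut_restr (inner l) is x |-> l x l^-1 with domain {x in G | l x l^-1 in G},
   i.e. the intersection of G and l^-1 G l. *)
Definition eta_star (l : L) : Comm G := comm_class (aut_restr (inner l)).

End Kappa.

Section Rigid.
Variable L : topologicalGroupType.

Definition tdlc : Prop :=
  totally_disconnected [set: L] /\ locally_compact [set: L].

Definition centralizer (g : L) : set L := [set x | x * g = g * x].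

Definition virtual_center : set L := [set g | open (centralizer g)].

Definition open_compact_subgroup (U : set L) : Prop :=
  [/\ is_subgroup U, open U & compact U].

Definition rigid : Prop :=
  forall (U V : set L) (f : L -> L),
    open_compact_subgroup U -> open_compact_subgroup V -> top_iso U V f ->
    exists! a : TopAut L, forall x, U x -> a x = f x.

End Rigid.

Arguments virtual_center L : clear implicits.

(* Main.v *)
(* The triviality of the virtual center makes an automorphism of L determined
   by its restriction to any open subgroup, so kappa is injective; rigidity is
   then surjectivity of kappa, and kappa matches the two bases at 1 because it
   sends i_g to iota(g).  As eta_* is kappa composed with the inner
   automorphisms, surjectivity of kappa makes its image normal.  Conversely, if
   the image is normal, an isomorphism f between open compact subgroups defines
   a class c in Comm(G), and conjugation by c, transported along the injective
   map eta_*, is an abstract automorphism of L; it extends f, hence it is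
   bicontinuous. *)
Require Import Defs.
From mathcomp Require Import all_boot.
From mathcomp Require Import boolp classical_sets functions topology.

Local Open Scope classical_set_scope.
Local Open Scope group_scope.

Set Implicit Arguments.
Unset Strict Implicit.

(** * Multiplicative maps between abstract groups *)

Section MulMorphisms.
Variables (K M : groupType) (h : K -> M).
Hypothesis hM : {morph h : x y / x * y}.

Lemma mul_morph1 : h 1 = 1.
Proof. by apply: (@mulgI _ (h 1)); rewrite -hM !mulg1. Qed.

Lemma mul_morphV x : h x^-1 = (h x)^-1.
Proof. by apply/esym/mulg1_eq; rewrite -hM mulgV mul_morph1. Qed.

End MulMorphisms.

(** * Topological groups and their automorphisms, controlled near 1 *)

Section TopologicalGroupTheory.
Implicit Types K M : topologicalGroupType.

Lemma lmulg_continuous K (g : K) : continuous (fun x : K => g * x).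
Proof.
move=> x; apply: (@continuous2_cvg _ _ _ _ _ _ (cst g) id (fun a b : K => a * b)).
- exact: (@mulg_continuous K (g, x)).
- exact: cvg_cst.
- exact: cvg_id.
Qed.

Lemma nbhs_lmulg K (g x : K) (A : set K) :
  nbhs (g * x) A -> nbhs x [set y | A (g * y)].
Proof. exact: (@lmulg_continuous K g x). Qed.

Lemma mul_morph_continuous K M (h : K -> M) : {morph h : x y / x * y} ->
  (forall A, nbhs (1 : M) A -> nbhs (1 : K) (h @^-1` A)) -> continuous h.
Proof.
move=> hM h1 x A hA; rewrite /= nbhs_simpl.
have /h1 : nbhs (1 : M) [set y | A (h x * y)] by apply: nbhs_lmulg; rewrite mulg1.
rewrite -{1}(mulVg x) => /nbhs_lmulg; apply: filterS => y /=.
by rewrite hM mul_morphV// mulVKg.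
Qed.

Lemma nbhs1_subgroup_open K (H : set K) :
  is_subgroup H -> nbhs (1 : K) H -> open H.
Proof.
move=> sH; rewrite openE => + x Hx.
rewrite -{1}(mulVg x) => /nbhs_lmulg; apply: filterS => y /= Hy.
by rewrite -(mulVKg x y); exact: (subgroupM sH).
Qed.

(** If [x] is in the closure of [H], the coset [xH] is a neighborhood of [x], so it meets [H] and
    [x] lies in [H]. *)
Lemma open_is_subgroup_closed K (H : set K) :
  is_subgroup H -> open H -> closed H.
Proof.
move=> sH oH x clHx.
have : nbhs x [set y | H (x^-1 * y)].
  apply: nbhs_lmulg; rewrite mulVg.
  by apply: open_nbhs_nbhs; split=> //; exact: subgroup1.
move=> /clHx[y [Hy /= /(subgroupV sH) Hxy]].
by have := subgroupM sH Hy Hxy; rewrite invgM invgK mulVKg.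
Qed.

Lemma conj_nbhs1 K (g : K) (A : set K) :
  nbhs (1 : K) A -> nbhs (1 : K) [set x | A (g * x * g^-1)].
Proof.
move=> A1; apply: (@aut_continuous K (inner g) 1 A).
by rewrite /= mulg1 mulgV.
Qed.

(** The centralizer of [g] is a subgroup, so it is open as soon as it contains a neighborhood of
    1. *)
Lemma virtual_center1 K (g : K) (A : set K) : virtual_center K = [set 1] ->
  nbhs (1 : K) A -> (forall x, A x -> x * g = g * x) -> g = 1.
Proof.
move=> VZ nA Ag; suff : virtual_center K g by rewrite VZ.
apply: nbhs1_subgroup_open; last exact: filterS nA.
split; rewrite /centralizer /=.
- by rewrite mul1g mulg1.
- by move=> x y xg yg; rewrite -mulgA yg mulgA xg mulgA.
- by move=> x xg; apply: (@mulgI _ x); rewrite mulVKg mulgA xg mulgK.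
Qed.

(** When [y] and its conjugate by [g] both lie in [A], applying [a] and [b] to that conjugate shows
    that [(b g)^-1 * a g] commutes with [b y]. Such [b y] fill a neighborhood of 1, so this element
    is trivial. *)
Lemma aut_eq_near1 K (a b : TopAut K) (A : set K) :
  virtual_center K = [set 1] -> nbhs (1 : K) A ->
  (forall x, A x -> a x = b x) -> a = b.
Proof.
move=> VZ nA ab; apply: TopAutP => g.
suff : (b g)^-1 * a g = 1 by move/mulg1_eq; rewrite invgK => ->.
pose B := [set x | A x /\ A (g * x * g^-1)].
have nB : nbhs (1 : K) B by apply: filterI => //; exact: conj_nbhs1.
pose bV : TopAut K := b^-1.
(* The preimage of [B] under the inverse of [b] is the image of [B] under [b]. *)
have nbB : nbhs (1 : K) (bV @^-1` B).
  apply: (@aut_continuous K bV 1); rewrite mul_morph1//; exact: autM.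
apply: virtual_center1 nbB _ => // x Bx.
have xE : x = b (bV x) by rewrite -[RHS]/((b * bV) x) mulgV.
move: (bV x) xE (Bx : B (bV x)) => y -> [Ay /ab] {x Bx}.
rewrite !autM !autV (ab _ Ay) => /(congr1 (fun z => (b g)^-1 * z * a g)).
by rewrite !mulgA mulgVK mulVg mul1g => ->.
Qed.

Lemma within_preimage_open_set K M (U : set K) (B : set M) (f : K -> M) :
  open U -> {within U, continuous f} -> open B -> open (U `&` f @^-1` B).
Proof.
move=> oU; rewrite continuous_open_subspace// => cf oB.
exact: (continuous_inP f oU).1.
Qed.

(** Agreement with [f] on [U] gives continuity at 1, which translations carry to every point. *)
Lemma mul_morph_eq_within_continuous K M (U : set K) (f h : K -> M) :
  {morph h : x y / x * y} -> is_subgroup U -> open U ->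
  {within U, continuous f} -> (forall x, U x -> h x = f x) -> continuous h.
Proof.
move=> hM sU oU cf hf; apply: mul_morph_continuous => // A.
rewrite nbhsE => -[B [oB B1] BA].
have U1 := subgroup1 sU.
rewrite nbhsE; exists (U `&` f @^-1` B).
  split; first exact: within_preimage_open_set.
  by split=> //=; rewrite -hf// mul_morph1.
by move=> x [Ux]; rewrite /= -hf// => /BA.
Qed.

(** Bicontinuity is inherited from [f]: [h] agrees with [f] on [U], and [k] with the inverse of [f]
    on [V]. *)
Lemma aut_extending K (U V : set K) (f h k : K -> K) :
  is_subgroup U -> is_subgroup V -> open U -> open V -> top_iso U V f ->
  {morph h : x y / x * y} -> cancel h k -> cancel k h ->
  (forall x, U x -> h x = f x) -> exists a : TopAut K, a =1 h.
Proof.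
move=> sU sV oU oV tf hM hK kK hf.
have kM : {morph k : x y / x * y}.
  by move=> x y; apply: (can_inj hK); rewrite hM !kK.
have [g [tg [_ fg]]] := top_iso_sym sU tf.
suff hiso : top_iso setT setT h by exists (MkTopAut hiso).
split.
- split=> //; first by move=> x y _ _; exact: (can_inj hK).
  by move=> y _; exists (k y).
- by move=> x y _ _; exact: hM.
- apply: continuous_subspaceT.
  exact: mul_morph_eq_within_continuous hM sU oU (top_iso_continuous tf) hf.
- exists k; first by move=> x _; exact: hK.
  apply: continuous_subspaceT.
  apply: mul_morph_eq_within_continuous kM sV oV (top_iso_continuous tg) _.
  move=> y Vy; apply: (can_inj hK); rewrite kK hf ?fg//.
  by have [[gVU _ _] _ _ _] := tg; exact: gVU.
Qed.

End TopologicalGroupTheory.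

(** * The maps [kappa] and [eta_star] for an open subgroup [G] *)

Section OpenSubgroup.
Variables (L : topologicalGroupType) (G : subgroup L).
Hypothesis oG : open (G : set L).
Implicit Types (a b : TopAut L) (U : open_subgroup G) (l : L).

Lemma open_subgroup_open_set U : open (U : set L).
Proof.
have := @open_subgroup_open _ _ U; rewrite -(open_setIS _ oG) (setIidl _)//.
exact: open_subgroup_sub.
Qed.

Lemma open_subgroup_nbhs1 U : nbhs (1 : L) (U : set L).
Proof.
apply: open_nbhs_nbhs; split; first exact: open_subgroup_open_set.
exact: subgroup1 (open_subgroup_is_subgroup U).
Qed.

Lemma open_subgroup_compact U : compact (G : set L) -> open_compact_subgroup U.
Proof.
move=> cG; have sU := open_subgroup_is_subgroup U.
split=> //; first exact: open_subgroup_open_set.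
apply: subclosed_compact cG _; last exact: open_subgroup_sub.
exact: open_is_subgroup_closed (open_subgroup_open_set U).
Qed.

Lemma kappaM : {morph kappa oG : a b / a * b}.
Proof.
move=> a b; rewrite comm_classM; apply/esym/comm_classP.
exists (vdom (virtual_comp (aut_restr oG a) (aut_restr oG b))) => // x.
by rewrite /= preimage_subgroupE /= !aut_domE => -[[? ?] [? ?]].
Qed.

Lemma kappa_inj : virtual_center L = [set 1] -> injective (kappa oG).
Proof.
move=> VZ a b /comm_classP[W _ ab].
exact: aut_eq_near1 VZ (open_subgroup_nbhs1 W) ab.
Qed.

Lemma eta_starE l : eta_star oG l = kappa oG (inner l).
Proof. by []. Qed.

Lemma eta_starM : {morph eta_star oG : x y / x * y}.
Proof. by move=> x y; rewrite !eta_starE innerM kappaM. Qed.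

(** If conjugations by [x] and [y] agree on [W], then [y^-1 * x] centralizes [W]. *)
Lemma eta_star_inj : virtual_center L = [set 1] -> injective (eta_star oG).
Proof.
move=> VZ x y /comm_classP[W _ xy].
suff : y^-1 * x = 1 by move/mulg1_eq; rewrite invgK => ->.
apply: virtual_center1 VZ (open_subgroup_nbhs1 W) _ => z /xy /=.
move=> /(congr1 (fun t => y^-1 * t * x)).
by rewrite !mulgA mulgVK mulVg mul1g => ->.
Qed.

(** This identity matches the basic neighborhoods of 1 in [TopAut L] and in [Comm G]. *)
Lemma eta_star_iota U (g : U) : eta_star oG (set_val g) = comm_iota g.
Proof.
apply: (@iota_eqP _ _ _ U) => // x Ux; have UG := @open_subgroup_sub _ _ U.
have sU := open_subgroup_is_subgroup U; have Ug := set_valP g.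
rewrite /= aut_domE; split; first exact: UG.
by apply: UG; apply: (subgroupM sU); [apply: (subgroupM sU) | apply: (subgroupV sU)].
Qed.

Lemma range_eta_star_subgroup : is_subgroup (range (eta_star oG)).
Proof.
split.
- by exists 1 => //; rewrite mul_morph1//; exact: eta_starM.
- by move=> _ _ [x _ <-] [y _ <-]; exists (x * y) => //; exact: eta_starM.
- by move=> _ [x _ <-]; exists x^-1 => //; rewrite mul_morphV//; exact: eta_starM.
Qed.

Lemma kappa_continuous : continuous (kappa oG).
Proof.
apply: mul_morph_continuous; first exact: kappaM.
move=> A /nbhs1_CommE[U UA]; apply/nbhs1_TopAutE; exists (U : set L).
  by split; [exact: open_subgroup_open_set | exact: open_subgroup_is_subgroup].
move=> _ [x Ux <-]; apply: UA; have [g <-] := rangeT_mem Ux.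
by exists g => //; rewrite -eta_star_iota.
Qed.

Lemma kappa_inv_continuous (k : Comm G -> TopAut L) :
  cancel (kappa oG) k -> cancel k (kappa oG) -> continuous k.
Proof.
move=> kappaK kK; apply: mul_morph_continuous.
  by move=> x y; apply: (can_inj kappaK); rewrite kappaM !kK.
move=> A /nbhs1_TopAutE[U [oU sU] UA]; apply/nbhs1_CommE.
(* An open subgroup of [L] need not lie in [G], so [U] is cut down to [G] to index a basic
   neighborhood of [Comm G]. *)
have UG : U `&` G `<=` G by move=> ? [].
have oUG : open (U `&` G : set (subspace G)).
  by rewrite open_subspaceIT; exact: open_subspaceW.
exists (OpenSubgroup (is_subgroupI sU (subgroupP G)) UG oUG).
move=> _ [g _ <-] /=; rewrite -eta_star_iota eta_starE kappaK.
by apply: UA; exists (set_val g) => //; have [] := set_valP g.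
Qed.

Lemma kappa_surj_top_iso : virtual_center L = [set 1] ->
  (forall c, exists a, kappa oG a = c) -> top_iso setT setT (kappa oG).
Proof.
move=> VZ /choice[k kK].
have kappaK : cancel (kappa oG) k by move=> a; apply: kappa_inj.
split.
- split=> //; first by move=> a b _ _; exact: kappa_inj.
  by move=> c _; exists (k c).
- by move=> a b _ _; exact: kappaM.
- exact/continuous_subspaceT/kappa_continuous.
- exists k => //; exact/continuous_subspaceT/kappa_inv_continuous.
Qed.

(** Open subgroups of the compact group [G] are closed, hence compact, so rigidity extends any
    representative of [c] to an automorphism of [L]. *)
Lemma rigid_kappa_surj : compact (G : set L) -> rigid L ->
  forall c, exists a, kappa oG a = c.
Proof.
move=> cG rL c; rewrite -(comm_reprK c); move: (comm_repr c) => f.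
have [a [af _]] := rL _ _ _ (open_subgroup_compact (vdom f) cG)
  (open_subgroup_compact (vcod f) cG) (viso f).
exists a; apply/comm_classP; exists (vdom f); last exact: af.
move=> x Ux.
split=> //=; rewrite aut_domE; split; first exact: open_subgroup_sub Ux.
by rewrite /= af//; exact/open_subgroup_sub/vfun_in.
Qed.

(** Writing [c] as [kappa oG a], conjugation by [c] sends the class of [inner l] to that of
    [inner (a l)]. *)
Lemma kappa_surj_normal : (forall c, exists a, kappa oG a = c) ->
  is_normal (range (eta_star oG)).
Proof.
move=> ks; split; first exact: range_eta_star_subgroup.
move=> c _ [l _ <-]; have [a <-] := ks c.
by exists (a l) => //; rewrite !eta_starE -innerJ !kappaM (mul_morphV kappaM).
Qed.

(** A restriction of [f] represents [c]. The identity still holds for every [l] in [U], even outside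
    [G], because [f] is multiplicative on all of [U] and classes are compared only near 1. *)
Lemma restriction_class (U V : set L) (f : L -> L) :
  is_subgroup U -> is_subgroup V -> open U -> open V -> top_iso U V f ->
  exists c : Comm G,
    forall l, U l -> c * eta_star oG l * c^-1 = eta_star oG (f l).
Proof.
move=> sU sV oU oV tf.
have [g [tg [gf fg]]] := top_iso_sym sU tf.
have [[/= fUV _ _] fM cf _] := tf; have [[/= gVU _ _] gM cg _] := tg.
have sG := subgroupP G.
(* Neither [U] nor [V] need lie in [G]; [W] is the part of [U] in [G] that [f] sends into [G], and
   [W'] is its image. *)
pose W := (U `&` f @^-1` G) `&` G.
pose W' := (V `&` g @^-1` G) `&` G.
have fW : f @` W = W'.
  apply/seteqP; split=> [_ [x [[Ux Gfx] Gx] <-]|y [[Vy Ggy] Gy]].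
    by split=> //; split; [exact: fUV | rewrite /= gf].
  exists (g y); last exact: fg.
  by split=> //; split; [exact: gVU | rewrite /= fg].
have WU : W `<=` U by move=> ? [[]].
have WG : W `<=` G by move=> ? [].
have WfG x : W x -> (G : set L) (f x) by case=> -[].
have W'G : W' `<=` G by move=> ? [].
have tW : top_iso W W' f by rewrite -fW; exact: top_iso_restrict tf.
have f1 : f 1 = 1.
  by apply: (@mulgI _ (f 1)); rewrite -fM ?mulg1//; exact: subgroup1.
have fV x : U x -> f x^-1 = (f x)^-1.
  move=> Ux; apply/esym/mulg1_eq; rewrite -fM ?mulgV//.
  exact: (subgroupV sU).
have sW : is_subgroup W.
  split.
  - by split; [split=> /=; [|rewrite f1]|]; exact: subgroup1.
  - move=> x y [[Ux Gfx] Gx] [[Uy Gfy] Gy].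
    split; last exact: (subgroupM sG).
    by split; [exact: (subgroupM sU) | rewrite /= fM//; exact: (subgroupM sG)].
  - move=> x [[Ux Gfx] Gx]; split; last exact: (subgroupV sG).
    by split; [exact: (subgroupV sU) | rewrite /= fV//; exact: (subgroupV sG)].
have sW' : is_subgroup W' by rewrite -fW; exact: top_iso_subgroup sU sW WU tf.
have oW : open W by apply: openI => //; exact: within_preimage_open_set.
have oW' : open W' by apply: openI => //; exact: within_preimage_open_set.
pose phi := @VirtualAut _ _ (OpenSubgroup sW WG (open_subspaceW oW))
  (OpenSubgroup sW' W'G (open_subspaceW oW')) f tW.
exists (comm_class phi) => l Ul.
suff -> : comm_class phi * eta_star oG l = eta_star oG (f l) * comm_class phi.
  by rewrite mulgK.
(* Both composites are defined on the open subgroup X. *)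
pose X := W `&` inner l @^-1` W.
have sX : is_subgroup X by apply: is_subgroupI => //; exact: aut_preimage_subgroup.
have XG : X `<=` G by move=> x [/WG].
have oX : open X.
  by apply: openI => //; apply: open_comp => // x _; exact: aut_continuous.
have Ulx x : W x -> f (l * x * l^-1) = f l * f x * (f l)^-1.
  move=> /WU Ux; rewrite !fM ?fV//; first exact: (subgroupM sU).
  exact: (subgroupV sU).
rewrite !comm_classM; apply/comm_classP.
exists (OpenSubgroup sX XG (open_subspaceW oX)) => x /= [Wx Wlx].
  split; rewrite preimage_subgroupE /= aut_domE; split=> //=.
    by split; exact: (WG).
  by split; [exact: (WfG) | rewrite /= -Ulx//; exact: (WfG)].
exact: Ulx.
Qed.

Lemma normal_rigid : virtual_center L = [set 1] ->
  is_normal (range (eta_star oG)) -> rigid L.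
Proof.
move=> VZ [_ nE] U V f [sU oU _] [sV oV _] tf.
have nU : nbhs (1 : L) U by apply: open_nbhs_nbhs; split=> //; exact: subgroup1.
have [c cf] := restriction_class sU sV oU oV tf.
have eI := eta_star_inj VZ.
(* Normality keeps conjugates in the range of [eta_star]; choice then lifts conjugation by [d] to a
   map on [L]. Taking [c] and [c^-1] for [d] yields inverse maps, by injectivity of [eta_star]. *)
have conjE d : exists h : L -> L,
    forall l, eta_star oG (h l) = d * eta_star oG l * d^-1.
  suff /choice[h hE] : forall l, exists m,
    eta_star oG m = d * eta_star oG l * d^-1 by exists h.
  by move=> l; have [|m _ mE] := nE d (eta_star oG l); [exists l | exists m].
have [h hE] := conjE c; have [k kE] := conjE c^-1.
have hM : {morph h : x y / x * y}.
  by move=> x y; apply: eI; rewrite eta_starM !hE eta_starM !mulgA mulgVK.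
have hK : cancel h k.
  by move=> x; apply: eI; rewrite kE hE invgK !mulgA mulVg mul1g mulgVK.
have kK : cancel k h.
  by move=> x; apply: eI; rewrite hE kE invgK !mulgA mulgV mul1g mulgK.
have hf x : U x -> h x = f x by move=> Ux; apply: eI; rewrite hE cf.
have [a ah] := aut_extending sU sV oU oV tf hM hK kK hf.
exists a; split=> [x Ux|b bf]; first by rewrite ah hf.
(* Uniqueness: two extensions agree on [U], a neighborhood of 1. *)
by apply: (aut_eq_near1 VZ nU) => x Ux; rewrite ah hf// bf.
Qed.

End OpenSubgroup.

Unset Implicit Arguments.
Set Strict Implicit.

Theorem proposition3p7 (L : topologicalGroupType) (G : subgroup L)
    (hL : tdlc L) (hVZ : virtual_center L = [set 1])
    (oG : open (G : set L)) (cG : compact (G : set L)) :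
  [<-> rigid L ;
       top_iso [set: TopAut L] [set: Comm G] (kappa oG) ;
       is_normal (range (eta_star oG))].
Proof.
tfae.
- move=> rL; apply: kappa_surj_top_iso => //; exact: rigid_kappa_surj.
- case=> -[_ _ ks] _ _ _; apply: kappa_surj_normal => c.
  by have [a _ ac] := ks c I; exists a.
- exact: normal_rigid.
Qed.
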